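(* Let $F$ be the function field of a smooth projective curve over $\mathbb{F}_q$, $x$ a place of $F$ with residue field $\kappa_x$ of cardinality $q_x$, and $[g]\in G(F)\backslash G(\mathbb{A})/K$. The $\Phi_x$-neighbours of $[g]$ are the classes $[g\xi_w]$ with $w\in\mathbb{P}^1(\kappa_x)$, and the multiplicity of an edge from $[g]$ to $[g']$ equals the number of $w\in\mathbb{P}^1(\kappa_x)$ such that $[g\xi_w]=[g']$. The multiplicities of the edges originating in $[g]$ sum up to $\#\mathbb{P}^1(\kappa_x)=q_x+1$.
   Context: $\mathbb{A}$ is the adele ring of $F$, $\mathcal{O}_{\mathbb{A}}=\prod_y\mathcal{O}_y$, $G=\mathrm{PGL}_2$, $K=G(\mathcal{O}_{\mathbb{A}})$, Haar measure on $G(\mathbb{A})$ with $\mathrm{vol}\,K=1$. $\pi_x$ is a uniformizer at $x$, viewed as an idele concentrated at $x$; elements $b\in\kappa_x\subset F_x$ are viewed as adeles with component $b$ at $x$ and $0$ elsewhere. Put $\xi_w=\begin{pmatrix}\pi_x&b\\0&1\end{pmatrix}$ if $w=[1:b]$ and $\xi_w=\begin{pmatrix}1&0\\0&\pi_x\end{pmatrix}$ if $w=[0:1]$. $\Phi_x$ is the characteristic function of $K\begin{pmatrix}\pi_x&0\\0&1\end{pmatrix}K$, acting by $\Phi_x(f)(g)=\int_{G(\mathbb{A})}\Phi_x(h)f(gh)\,dh$. For each $[g]$ there are unique pairwise distinct classes $[g_1],\dots,[g_r]$ and numbers $m_i\in\mathbb{C}^\times$ with $\Phi_x(f)(g)=\sum_im_if(g_i)$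 for all functions $f$ on $G(F)\backslash G(\mathbb{A})/K$. The $[g_i]$ are the $\Phi_x$-neighbours of $[g]$, the triples $([g],[g_i],m_i)$ are the edges originating in $[g]$, and $m_i$ is called their multiplicity (or weight). *)

(* Defs.v *)
From HB Require Import structures.
From mathcomp Require Import all_boot all_order all_algebra all_field.
From mathcomp Require Import all_classical all_reals all_analysis.
From mathcomp Require Import complex.

Set Implicit Arguments.
Unset Strict Implicit.
Unset Printing Implicit Defensive.

Import Order.TTheory GRing.Theory Num.Theory.
Local Open Scope classical_set_scope.
Local Open Scope quotient_scope.
Local Open Scope ring_scope.

(* The value -oo is excluded by [valM] and [val_surj]: together they force
   v 1 = 0, whence v a is finite for a != 0. *)
Record is_valuation (L : fieldType) (v : L -> \bar int) : Prop := IsValuation {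
  val_eq_oo : forall a, v a = +oo%E <-> a = 0;
  valM : forall a b, v (a * b) = (v a + v b)%E;
  valD : forall a b, (Order.min (v a) (v b) <= v (a + b)%R)%E;
  val_surj : exists a, v a = 1%:E
}.

(* Over a finite constant field every discrete valuation is trivial on the
   constants (nonzero constants are roots of unity), so that no such condition
   is needed: these are the closed points of the curve. *)
Record place (F : fieldType) := Place {
  pval :> F -> \bar int;
  pval_valuation : is_valuation pval
}.

HB.instance Definition _ (F : fieldType) := gen_eqMixin (place F).
HB.instance Definition _ (F : fieldType) := gen_choiceMixin (place F).

Record completion (F : fieldType) (v : F -> \bar int) := Completion {
  cfield :> fieldType;
  cval : cfield -> \bar int;
  cembed : {rmorphism F -> cfield};
  cval_valuation : is_valuation cval;
  cvalE : forall f, cval (cembed f) = v f;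
  cembed_dense : forall (a : cfield) (n : int),
    exists f, (n%:E <= cval (a - cembed f)%R)%E;
  cval_complete : forall u : nat -> cfield,
    (forall n : int, exists N, forall i j, (N <= i)%N -> (N <= j)%N ->
       (n%:E <= cval (u i - u j)%R)%E) ->
    exists l, forall n : int, exists N, forall i, (N <= i)%N ->
       (n%:E <= cval (u i - l)%R)%E
}.

Definition integers (L : fieldType) (v : L -> \bar int) : set L :=
  [set a | (0 <= v a)%E].

Record uniformizer (L : fieldType) (v : L -> \bar int) := Uniformizer {
  unif :> L;
  unif_val : v unif = 1%:E
}.

(* [r] exhibits [kappa] as the quotient of the valuation ring by its maximal
   ideal; its values outside of the valuation ring are irrelevant. *)
Record is_residue_map (L : fieldType) (v : L -> \bar int) (kappa : fieldType)
    (r : L -> kappa) : Prop := IsResidueMap {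
  res_one : r 1 = 1;
  res_add : forall a b, integers v a -> integers v b -> r (a + b) = r a + r b;
  res_mul : forall a b, integers v a -> integers v b -> r (a * b) = r a * r b;
  res_surj : forall c, exists2 a, integers v a & r a = c;
  res_ker : forall a, integers v a -> (r a = 0 <-> (0 < v a)%E)
}.

(* The inclusion of the residue field into a complete field of equal
   characteristic, as a field of representatives.  For finite [kappa] it is
   unique: its values are the Teichmueller representatives. *)
Definition is_residue_embedding (L : fieldType) (v : L -> \bar int)
    (kappa : fieldType) (r : L -> kappa) (e : {rmorphism kappa -> L}) :=
  forall b, integers v (e b) /\ r (e b) = b.

Section ValuationTheory.
Variables (L : fieldType) (v : L -> \bar int).
Hypothesis vV : is_valuation v.

Lemma val1 : v 1 = 0%E.
Proof.
have [t vt] := val_surj vV.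
have := valM vV t 1; rewrite mulr1 vt.
case: (v 1) => [n| |] //= [] h; congr EFin.
by apply: (addrI 1); rewrite addr0 [RHS]h.
Qed.

Lemma integers1 : integers v 1.
Proof. by rewrite /integers /= val1. Qed.

Lemma integers0 : integers v 0.
Proof. by rewrite /integers /= (proj2 (val_eq_oo vV 0)) // leey. Qed.

Lemma integersD a b : integers v a -> integers v b -> integers v (a + b).
Proof.
move=> /= va vb; apply: le_trans (valD vV a b).
by rewrite le_min va vb.
Qed.

Lemma integersM a b : integers v a -> integers v b -> integers v (a * b).
Proof. by rewrite /integers /= => va vb; rewrite (valM vV) adde_ge0. Qed.

Lemma valN a : v (- a) = v a.
Proof.
have vN1 : v (-1) = 0%E.
  have := valM vV (-1) (-1); rewrite mulrNN mulr1 val1.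
  case: (v (-1)) => [n| |] //= [] /esym/eqP; rewrite -mulr2n.
  by rewrite mulrn_eq0 /= => /eqP ->.
by rewrite -mulN1r (valM vV) vN1 add0e.
Qed.

Lemma integersN a : integers v a -> integers v (- a).
Proof. by rewrite /integers /= valN. Qed.

End ValuationTheory.

Definition valuation_topology (L : fieldType) (v : L -> \bar int) : Type := L.

Section ValuationTopology.
Variables (L : fieldType) (v : L -> \bar int).
Local Notation T := (valuation_topology v).

Definition valuation_open : set (set T) :=
  [set U | forall a : L, U a ->
     exists n : int, [set b : L | (n%:E <= v (b - a)%R)%E] `<=` U].

Lemma valuation_openT : valuation_open setT.
Proof. by move=> a _; exists 0. Qed.

Lemma valuation_openI : setI_closed valuation_open.
Proof.
move=> U V oU oV a [Ua Va].
have [n nU] := oU _ Ua; have [m mV] := oV _ Va.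
exists (Order.max n m) => b /= nmb; split.
  by apply: nU => /=; apply: le_trans nmb; rewrite lee_fin le_max lexx.
by apply: mV => /=; apply: le_trans nmb; rewrite lee_fin le_max lexx orbT.
Qed.

Lemma valuation_open_bigU (I : Type) (U : I -> set T) :
  (forall i, valuation_open (U i)) -> valuation_open (\bigcup_i U i).
Proof.
move=> oU a [i _ Ua]; have [n nU] := oU i a Ua.
by exists n => b /nU ?; exists i.
Qed.

HB.instance Definition _ := Choice.copy T L.
HB.instance Definition _ := isOpenTopological.Build T
  valuation_openT valuation_openI valuation_open_bigU.

Lemma valuation_openE : (open : set (set T)) = valuation_open.
Proof. by []. Qed.

Lemma open_integers : is_valuation v -> open (integers v : set T).
Proof.
move=> vV; rewrite valuation_openE => a va; exists 0 => b /= vb.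
by rewrite -(subrK a b); exact: integersD.
Qed.

End ValuationTopology.

Section Adeles.
Variables (F : fieldType) (Fhat : forall y : place F, completion y).

Record adele := Adele {
  acomp :> forall y, Fhat y;
  acomp_fin : finite_set [set y | ~ integers (@cval _ _ (Fhat y)) (acomp y)]
}.

HB.instance Definition _ := gen_eqMixin adele.
HB.instance Definition _ := gen_choiceMixin adele.

Implicit Types a b c : adele.

Local Notation OO y := (integers (@cval _ _ (Fhat y))).

Lemma adele_ext a b : (forall y, a y = b y) -> a = b.
Proof.
case: a b => [a fa] [b fb] /= ab.
have ? : a = b by apply: functional_extensionality_dep.
by subst b; congr Adele; exact: Prop_irrelevance.
Qed.

Lemma adele_fin1 (d : forall y, Fhat y) : (forall y, OO y (d y)) ->
  finite_set [set y | ~ OO y (d y)].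
Proof.
move=> Od; rewrite [X in finite_set X](_ : _ = set0) //.
by apply/seteqP; split=> y // /(_ (Od y)).
Qed.

Lemma finite_setU2 T (A B : set T) :
  finite_set A -> finite_set B -> finite_set (A `|` B).
Proof. by rewrite finite_setU. Qed.

Lemma adele_fin2 a b (d : forall y, Fhat y) :
  (forall y, OO y (a y) -> OO y (b y) -> OO y (d y)) ->
  finite_set [set y | ~ OO y (d y)].
Proof.
move=> abd.
apply: sub_finite_set (finite_setU2 (acomp_fin a) (acomp_fin b)) => y /= nd.
by apply/not_andP => -[Oa Ob]; exact: nd (abd y Oa Ob).
Qed.

Definition adele0 := Adele (adele_fin1 (d := fun=> 0)
  (fun y => integers0 (cval_valuation (Fhat y)))).
Definition adele1 := Adele (adele_fin1 (d := fun=> 1)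
  (fun y => integers1 (cval_valuation (Fhat y)))).
Definition adele_opp a := Adele (adele_fin2 (a := a) (b := a)
  (d := fun y => - a y)
  (fun y Oa _ => integersN (cval_valuation (Fhat y)) Oa)).
Definition adele_add a b := Adele (adele_fin2 (a := a) (b := b)
  (d := fun y => a y + b y)
  (fun y Oa Ob => integersD (cval_valuation (Fhat y)) Oa Ob)).
Definition adele_mul a b := Adele (adele_fin2 (a := a) (b := b)
  (d := fun y => a y * b y)
  (fun y Oa Ob => integersM (cval_valuation (Fhat y)) Oa Ob)).

Lemma adele_addA : associative adele_add.
Proof. by move=> a b c; apply: adele_ext => y /=; rewrite addrA. Qed.
Lemma adele_addC : commutative adele_add.
Proof. by move=> a b; apply: adele_ext => y /=; rewrite addrC. Qed.
Lemma adele_add0 : left_id adele0 adele_add.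
Proof. by move=> a; apply: adele_ext => y /=; rewrite add0r. Qed.
Lemma adele_addN : left_inverse adele0 adele_opp adele_add.
Proof. by move=> a; apply: adele_ext => y /=; rewrite addNr. Qed.
HB.instance Definition _ := GRing.isZmodule.Build adele
  adele_addA adele_addC adele_add0 adele_addN.

Lemma adele_mulA : associative adele_mul.
Proof. by move=> a b c; apply: adele_ext => y /=; rewrite mulrA. Qed.
Lemma adele_mulC : commutative adele_mul.
Proof. by move=> a b; apply: adele_ext => y /=; rewrite mulrC. Qed.
Lemma adele_mul1 : left_id adele1 adele_mul.
Proof. by move=> a; apply: adele_ext => y /=; rewrite mul1r. Qed.
Lemma adele_mulDl : left_distributive adele_mul adele_add.
Proof. by move=> a b c; apply: adele_ext => y /=; rewrite mulrDl. Qed.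
HB.instance Definition _ := GRing.Zmodule_isComPzRing.Build adele
  adele_mulA adele_mulC adele_mul1 adele_mulDl.

Lemma adele_compD a b y : (a + b) y = a y + b y. Proof. by []. Qed.
Lemma adele_compM a b y : (a * b) y = a y * b y. Proof. by []. Qed.
Lemma adele_comp1 y : (1 : adele) y = 1. Proof. by []. Qed.
Lemma adele_comp0 y : (0 : adele) y = 0. Proof. by []. Qed.

Definition integral_adele : set adele := [set a | forall y, OO y (a y)].

Definition diagonal (f : F) a := forall y, a y = cembed (Fhat y) f.

Lemma adele_at_fin a (x : place F) (t : Fhat x) :
  finite_set [set y | ~ OO y (eqtype.dfwith a t y)].
Proof.
apply: sub_finite_set (finite_setU2 (finite_set1 x) (acomp_fin a)) => y /=.
by case: eqtype.dfwithP => [|z _ nz]; [left|right].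
Qed.

(* component t at x, the components of a elsewhere *)
Definition adele_at a (x : place F) (t : Fhat x) := Adele (adele_at_fin a t).

(* Basis of the restricted product topology: products of open subsets of the
   completions, almost all of which are the full ring of integers. *)
Definition restricted_box (U : forall y, set (Fhat y)) : set adele :=
  [set a | forall y, U y (a y)].

Definition restricted_family (U : forall y, set (Fhat y)) :=
  (forall y, open (U y : set (valuation_topology (@cval _ _ (Fhat y))))) /\
  finite_set [set y | U y <> OO y].

Definition adele_boxes : set (set adele) :=
  [set restricted_box U | U in restricted_family].

Lemma adele_boxes_cover : \bigcup_(B in adele_boxes) B = setT.
Proof.
apply/seteqP; split=> // a _.
pose U y : set (Fhat y) := if pselect (OO y (a y)) then OO y else setT.
exists (restricted_box U); last by move=> y; rewrite /U; case: (pselect (OO y (a y))).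
exists U => //; split=> [y|].
  rewrite /U; case: (pselect (OO y (a y))) => [Oa|nOa]; last exact: openT.
  exact: open_integers (cval_valuation _).
apply: sub_finite_set (acomp_fin a) => y /=.
by rewrite /U; case: (pselect (OO y (a y))).
Qed.

Lemma adele_boxes_join (A B : set adele) a :
  adele_boxes A -> adele_boxes B -> A a -> B a ->
  exists C, [/\ adele_boxes C, C a & C `<=` A `&` B].
Proof.
move=> [U [oU fU] <-] [V [oV fV] <-] Ua Va.
exists (restricted_box (fun y => U y `&` V y)); split => //.
- exists (fun y => U y `&` V y) => //; split=> [y|]; first exact: openI.
  apply: sub_finite_set (finite_setU2 fU fV) => y /= UV.
  by apply/not_andP => -[Uy Vy]; apply: UV; rewrite Uy Vy setIid.
- by move=> b UVb; split=> y; have [] := UVb y.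
Qed.

HB.instance Definition _ := @isBaseTopological.Build adele
  (set adele) adele_boxes id adele_boxes_cover adele_boxes_join.

End Adeles.

Section GL2.
Variable R : comPzRingType.

Record GL2 := MkGL2 {
  gl_mx :> 'M[R]_2;
  gl_inv : 'M[R]_2;
  gl_mulmxV : gl_mx *m gl_inv = 1%:M;
  gl_mulVmx : gl_inv *m gl_mx = 1%:M
}.

HB.instance Definition _ := gen_eqMixin GL2.
HB.instance Definition _ := gen_choiceMixin GL2.

Lemma gl_ext (g h : GL2) : gl_mx g = gl_mx h -> g = h.
Proof.
case: g h => [g g' gg' g'g] [h h' hh' h'h] /= gh.
have ghV : g' = h' by rewrite -[g']mulmx1 -hh' -gh mulmxA g'g mul1mx.
by subst h h'; congr MkGL2; exact: Prop_irrelevance.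
Qed.

Definition gl_one : GL2 := MkGL2 (mulmx1 1%:M) (mulmx1 1%:M).
Definition gl_invg (g : GL2) : GL2 := MkGL2 (gl_mulVmx g) (gl_mulmxV g).

Lemma gl_mul_subproof (g h : GL2) :
  (g *m h) *m (gl_inv h *m gl_inv g) = 1%:M /\
  (gl_inv h *m gl_inv g) *m (g *m h) = 1%:M.
Proof.
split.
  by rewrite mulmxA -(mulmxA (gl_mx g)) gl_mulmxV mulmx1 gl_mulmxV.
by rewrite mulmxA -(mulmxA (gl_inv h)) gl_mulVmx mulmx1 gl_mulVmx.
Qed.

Definition gl_mul (g h : GL2) : GL2 :=
  MkGL2 (gl_mul_subproof g h).1 (gl_mul_subproof g h).2.

Lemma gl_mulA : associative gl_mul.
Proof. by move=> g h k; apply: gl_ext => /=; rewrite mulmxA. Qed.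
Lemma gl_mul1g : left_id gl_one gl_mul.
Proof. by move=> g; apply: gl_ext => /=; rewrite mul1mx. Qed.
Lemma gl_mulg1 : right_id gl_one gl_mul.
Proof. by move=> g; apply: gl_ext => /=; rewrite mulmx1. Qed.
Lemma gl_mulVg : left_inverse gl_one gl_invg gl_mul.
Proof. by move=> g; apply: gl_ext => /=; rewrite gl_mulVmx. Qed.
Lemma gl_mulgV : right_inverse gl_one gl_invg gl_mul.
Proof. by move=> g; apply: gl_ext => /=; rewrite gl_mulmxV. Qed.
HB.instance Definition _ := isGroup.Build GL2
  gl_mulA gl_mul1g gl_mulg1 gl_mulVg gl_mulgV.

Definition mx2 (a b c d : R) : 'M[R]_2 :=
  \matrix_(i, j) if i == ord0 then (if j == ord0 then a else b)
                 else (if j == ord0 then c else d).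

Lemma mx2_mul a b c d a' b' c' d' :
  mx2 a b c d *m mx2 a' b' c' d' =
  mx2 (a * a' + b * c') (a * b' + b * d') (c * a' + d * c') (c * b' + d * d').
Proof.
apply/matrixP => i j; rewrite !mxE !big_ord_recl big_ord0 addr0 !mxE /=.
by case: (i == ord0); case: (j == ord0).
Qed.

Lemma mx2_1 : mx2 1 0 0 1 = 1%:M.
Proof.
by apply/matrixP => i j; rewrite !mxE; case: i => [[|[]]] //= ?;
   case: j => [[|[]]].
Qed.

Lemma gl_upper_subproof a a' b d d' : a * a' = 1 -> d * d' = 1 ->
  mx2 a b 0 d *m mx2 a' (- (a' * b * d')) 0 d' = 1%:M /\
  mx2 a' (- (a' * b * d')) 0 d' *m mx2 a b 0 d = 1%:M.
Proof.
move=> aa' dd'; have a'a : a' * a = 1 by rewrite mulrC.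
have d'd : d' * d = 1 by rewrite mulrC.
rewrite !mx2_mul !mulr0 !mul0r !addr0 !add0r aa' dd' a'a d'd.
rewrite mulrN !mulrA aa' mul1r addNr.
by rewrite mulNr -(mulrA _ d') d'd mulr1 subrr mx2_1.
Qed.

(* (a b; 0 d), given inverses a' of a and d' of d *)
Definition gl_upper a a' b d d' (aa' : a * a' = 1) (dd' : d * d' = 1) : GL2 :=
  MkGL2 (gl_upper_subproof b aa' dd').1 (gl_upper_subproof b aa' dd').2.

(* PGL_2(R) is taken to be GL_2(R) / R^*; for the adele ring this is the group
   of adelic points of the algebraic group PGL_2. *)
Definition pgl_rel (g h : GL2) : bool :=
  `[< exists a b : R, a * b = 1 /\ gl_mx h = a *: gl_mx g >].

Lemma pgl_rel_refl : reflexive pgl_rel.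
Proof. by move=> g; apply/asboolP; exists 1, 1; rewrite mul1r scale1r. Qed.
Lemma pgl_rel_sym : symmetric pgl_rel.
Proof.
move=> g h; apply/asboolP/asboolP => -[a [b [ab E]]];
  by exists b, a; rewrite E scalerA mulrC ab scale1r.
Qed.
Lemma pgl_rel_trans : transitive pgl_rel.
Proof.
move=> h g k /asboolP[a [b [ab Eh]]] /asboolP[c [d [cd Ek]]].
apply/asboolP; exists (c * a), (d * b); rewrite Ek Eh.
by rewrite mulrACA cd ab mulr1 scalerA.
Qed.
Canonical pgl_equiv := EquivRel pgl_rel pgl_rel_refl pgl_rel_sym pgl_rel_trans.

Definition PGL2 : Type := {eq_quot pgl_rel}.
HB.instance Definition _ := EqQuotient.on PGL2.
HB.instance Definition _ := Choice.on PGL2.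

Definition pgl_of (g : GL2) : PGL2 := \pi_PGL2 g.

Lemma pgl_ofP (g h : GL2) : reflect
  (exists a b : R, a * b = 1 /\ gl_mx h = a *: gl_mx g) (pgl_of g == pgl_of h).
Proof. by rewrite /pgl_of eqmodE; exact: asboolP. Qed.

Definition pgl_one : PGL2 := pgl_of 1%g.
Definition pgl_inv (g : PGL2) : PGL2 := pgl_of (repr g)^-1%g.
Definition pgl_mul (g h : PGL2) : PGL2 := pgl_of (repr g * repr h)%g.

Lemma pgl_reprK (g : PGL2) : pgl_of (repr g) = g.
Proof. exact: reprK. Qed.

Lemma pgl_of_mul (g h : GL2) : pgl_mul (pgl_of g) (pgl_of h) = pgl_of (g * h)%g.
Proof.
have /eqP/pgl_ofP[a [b [ab Eg]]] := pgl_reprK (pgl_of g).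
have /eqP/pgl_ofP[c [d [cd Eh]]] := pgl_reprK (pgl_of h).
apply/eqP/pgl_ofP; exists (a * c), (b * d); split.
  by rewrite mulrACA ab cd mulr1.
by rewrite /= Eg Eh -scalemxAl -scalemxAr scalerA.
Qed.

Lemma pgl_of_inv (g : GL2) : pgl_inv (pgl_of g) = pgl_of g^-1%g.
Proof.
have /eqP/pgl_ofP[a [b [ab Eg]]] := pgl_reprK (pgl_of g).
set r := repr (pgl_of g) in Eg *.
have Er : gl_mx r = b *: gl_mx g by rewrite Eg scalerA mulrC ab scale1r.
apply/eqP/pgl_ofP; exists b, a; split; first by rewrite mulrC.
by rewrite /= -[LHS]mulmx1 -(gl_mulmxV r) mulmxA Er -scalemxAr gl_mulVmx
  -scalemxAl mul1mx.
Qed.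

Lemma pgl_mulA : associative pgl_mul.
Proof.
move=> g h k; rewrite -(pgl_reprK g) -(pgl_reprK h) -(pgl_reprK k).
by rewrite !pgl_of_mul mulgA.
Qed.
Lemma pgl_mul1g : left_id pgl_one pgl_mul.
Proof. by move=> g; rewrite -(pgl_reprK g) pgl_of_mul mul1g. Qed.
Lemma pgl_mulg1 : right_id pgl_one pgl_mul.
Proof. by move=> g; rewrite -(pgl_reprK g) pgl_of_mul mulg1. Qed.
Lemma pgl_mulVg : left_inverse pgl_one pgl_inv pgl_mul.
Proof. by move=> g; rewrite -(pgl_reprK g) pgl_of_inv pgl_of_mul mulVg. Qed.
Lemma pgl_mulgV : right_inverse pgl_one pgl_inv pgl_mul.
Proof. by move=> g; rewrite -(pgl_reprK g) pgl_of_inv pgl_of_mul mulgV. Qed.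
HB.instance Definition _ := isGroup.Build PGL2
  pgl_mulA pgl_mul1g pgl_mulg1 pgl_mulVg pgl_mulgV.
HB.instance Definition _ := isPointed.Build PGL2 1%g.

End GL2.

Section AdelicGroup.
Variables (F : fieldType) (Fhat : forall y : place F, completion y).
Local Notation A := (adele Fhat).

(* GL_2(A) carries the topology that makes both g and g^-1 continuous in
   M_2(A), not the subspace topology of M_2(A). *)
Definition gl_pair (g : GL2 A) : 'M[A]_2 * 'M[A]_2 := (gl_mx g, gl_inv g).

HB.instance Definition _ :=
  Topological.copy (GL2 A) (initial_topology gl_pair).

Definition pgl_open : set (set (PGL2 A)) :=
  [set U | open ((@pgl_of A) @^-1` U)].

Lemma pgl_openT : pgl_open setT.
Proof. by rewrite /pgl_open /= preimage_setT; exact: openT. Qed.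
Lemma pgl_openI : setI_closed pgl_open.
Proof. by move=> U V oU oV; exact: openI. Qed.
Lemma pgl_open_bigU (I : Type) (U : I -> set (PGL2 A)) :
  (forall i, pgl_open (U i)) -> pgl_open (\bigcup_i U i).
Proof. by move=> oU; apply: bigcup_open => i _; exact: oU. Qed.
HB.instance Definition _ := isOpenTopological.Build (PGL2 A)
  pgl_openT pgl_openI pgl_open_bigU.

Definition GA : Type := PGL2 A.
HB.instance Definition _ := Group.on GA.
HB.instance Definition _ := Topological.on GA.
HB.instance Definition _ := Pointed.on GA.

(* The maximal compact subgroup K = G(O_A), as the image of GL_2(O_A). *)
Definition GO : set GA := [set pgl_of k | k in [set k : GL2 A |
  forall i j, integral_adele (gl_mx k i j) /\ integral_adele (gl_inv k i j)]].

(* The diagonal image of G(F) in G(A). *)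
Definition GF : set GA := [set pgl_of g | g in [set g : GL2 A |
  exists m : GL2 F, forall i j, diagonal (gl_mx m i j) (gl_mx g i j)]].

Definition borelG := g_sigma_algebraType (@open GA).

Record haar_measure (R : realType) (mu : {measure set borelG -> \bar R}) : Prop :=
  HaarMeasure {
  haar_invl : forall (g : GA) (E : set borelG), measurable E ->
    mu [set (g * h)%g | h in (E : set GA)] = mu E;
  haar_nontriv : exists2 E, measurable E & mu E <> 0%E;
  haar_compact : forall C : set GA, compact C -> (mu C < +oo)%E;
  haar_outer : forall E : set borelG, measurable E ->
    mu E = ereal_inf [set mu U | U in [set U : set GA | open U /\ E `<=` U]];
  haar_inner : forall U : set GA, open U ->
    mu U = ereal_sup [set mu C | C in [set C : set GA | compact C /\ C `<=` U]]
}.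

Lemma GO1 : GO 1%g.
Proof.
exists 1%g => //= i j; rewrite mxE.
by split=> y; case: (i == j); rewrite ?adele_comp1 ?adele_comp0;
  [exact: integers1 (cval_valuation _)|exact: integers0 (cval_valuation _)
  |exact: integers1 (cval_valuation _)|exact: integers0 (cval_valuation _)].
Qed.

Lemma integral_mulmx (M N : 'M[A]_2) :
  (forall i j, integral_adele (M i j)) ->
  (forall i j, integral_adele (N i j)) ->
  forall i j, integral_adele ((M *m N) i j).
Proof.
move=> OM ON i j y; rewrite mxE !big_ord_recl big_ord0 addr0.
by apply: integersD (cval_valuation _) _ _ _ _;
  apply: integersM (cval_valuation _) _ _ _ _; (exact: OM || exact: ON).
Qed.

Lemma GOM g h : GO g -> GO h -> GO (g * h)%g.
Proof.
move=> [k Ok <-] [l Ol <-]; exists (k * l)%g; last by rewrite -pgl_of_mul.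
move=> i j; split; apply: integral_mulmx => {}i {}j;
  by have [? ?] := Ok i j; have [? ?] := Ol i j.
Qed.

Lemma GOV g : GO g -> GO g^-1%g.
Proof.
move=> [k Ok <-]; exists k^-1%g; last by rewrite -pgl_of_inv.
by move=> i j; have [] := Ok i j.
Qed.

Lemma GF1 : GF 1%g.
Proof.
exists 1%g => //=; exists 1%g => i j y /=; rewrite !mxE.
by case: (i == j); rewrite ?adele_comp1 ?adele_comp0 ?rmorph1 ?rmorph0.
Qed.

Lemma GFM g h : GF g -> GF h -> GF (g * h)%g.
Proof.
move=> [k [m km] <-] [l [n ln] <-]; exists (k * l)%g; last by rewrite -pgl_of_mul.
exists (m * n)%g => i j y /=; rewrite !mxE !big_ord_recl !big_ord0 !addr0.
by rewrite adele_compD !adele_compM !(km, ln) rmorphD !rmorphM.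
Qed.

Lemma GFV g : GF g -> GF g^-1%g.
Proof.
move=> [k [m km] <-]; exists k^-1%g; last by rewrite -pgl_of_inv.
exists m^-1%g => i j y /=.
pose comp (M : 'M[A]_2) : 'M[Fhat y]_2 := \matrix_(i, j) (M i j y).
have compM M N : comp (M *m N) = comp M *m comp N.
  by apply/matrixP => a b; rewrite !mxE !big_ord_recl !big_ord0 !mxE !addr0.
have comp1 : comp 1%:M = 1%:M.
  apply/matrixP => a b; rewrite !mxE.
  by case: (a == b); rewrite ?adele_comp1 ?adele_comp0.
have compk : comp k = map_mx (cembed (Fhat y)) m.
  by apply/matrixP => a b; rewrite !mxE km.
have : comp (gl_inv k) = map_mx (cembed (Fhat y)) (gl_inv m).
  rewrite -[RHS]mul1mx -comp1 -(gl_mulVmx k) compM compk -mulmxA -map_mxM.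
  by rewrite gl_mulmxV map_mx1 mulmx1.
by move=> /matrixP/(_ i j); rewrite !mxE.
Qed.

Definition dcoset_rel (g h : GA) : bool :=
  `[< exists2 c, GF c & exists2 k, GO k & h = (c * g * k)%g >].

Lemma dcoset_rel_refl : reflexive dcoset_rel.
Proof.
move=> g; apply/asboolP; exists 1%g; first exact: GF1.
by exists 1%g; [exact: GO1|rewrite mul1g mulg1].
Qed.
Lemma dcoset_rel_sym : symmetric dcoset_rel.
Proof.
suff S g h : dcoset_rel g h -> dcoset_rel h g.
  by move=> g h; apply/idP/idP; exact: S.
move=> /asboolP[c Fc [k Ok ->]]; apply/asboolP; exists c^-1%g; first exact: GFV.
by exists k^-1%g; [exact: GOV|rewrite !mulgA mulVg mul1g mulgK].
Qed.
Lemma dcoset_rel_trans : transitive dcoset_rel.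
Proof.
move=> h g l /asboolP[c Fc [k Ok ->]] /asboolP[d Fd [k' Ok' ->]].
apply/asboolP; exists (d * c)%g; first exact: GFM.
by exists (k * k')%g; [exact: GOM|rewrite !mulgA].
Qed.
Canonical dcoset_equiv :=
  EquivRel dcoset_rel dcoset_rel_refl dcoset_rel_sym dcoset_rel_trans.

(* G(F) \ G(A) / K *)
Definition dcosets : Type := {eq_quot dcoset_rel}.
HB.instance Definition _ := EqQuotient.on dcosets.
HB.instance Definition _ := Choice.on dcosets.

Definition dcoset (g : GA) : dcosets := \pi_dcosets g.

Definition cintegral (R : realType) (mu : {measure set borelG -> \bar R})
    (f : GA -> R[i]) : R[i] :=
  Complex (\int[mu]_(h in [set: borelG]) complex.Re (f h))
          (\int[mu]_(h in [set: borelG]) complex.Im (f h)).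

Section Hecke.
Variables (R : realType) (mu : {measure set borelG -> \bar R}).
Variables (x : place F) (pi : uniformizer (@cval _ _ (Fhat x))).

Lemma unif_neq0 : (pi : Fhat x) != 0.
Proof.
apply/eqP => pi0; have := unif_val pi; rewrite pi0.
by rewrite (proj2 (val_eq_oo (cval_valuation (Fhat x)) 0)).
Qed.

(* the uniformizer as an idele: 1 away from x *)
Definition unif_idele : A := adele_at 1 (pi : Fhat x).

Lemma unif_ideleV : unif_idele * adele_at 1 (pi : Fhat x)^-1 = 1.
Proof.
apply: adele_ext => y; rewrite adele_compM /=.
have [exy|xy] := eqVneq x y.
  subst y; by rewrite !eqtype.dfwith_in; exact: mulfV unif_neq0.
by rewrite !eqtype.dfwith_out // mulr1.
Qed.

(* (pi b; 0 1) *)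
Definition xi_fin (b : A) : GA :=
  pgl_of (gl_upper b unif_ideleV (mulr1 1)).
(* (1 0; 0 pi) *)
Definition xi_inf : GA :=
  pgl_of (gl_upper 0 (mulr1 1) unif_ideleV).

(* K (pi 0; 0 1) K *)
Definition hecke_support : set GA :=
  [set (k.1 * xi_fin 0 * k.2)%g | k in GO `*` GO].

Definition hecke (f : dcosets -> R[i]) (g : GA) : R[i] :=
  cintegral mu (fun h => \1_hecke_support h * f (dcoset (g * h)%g)).

Definition hecke_expansion (g : GA) (s : seq (dcosets * R[i])) :=
  [/\ uniq [seq e.1 | e <- s],
      (forall e, e \in s -> e.2 != 0) &
      forall f, hecke f g = \sum_(e <- s) e.2 * f e.1].

(* triples (origin, terminus, multiplicity) *)
Definition hecke_edges (g : GA) : set (dcosets * dcosets * R[i]) :=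
  [set (dcoset g, e.1, e.2) | e in
     [set e | exists2 s, hecke_expansion g s & e \in s]].

Definition hecke_neighbours (g : GA) : set dcosets :=
  [set e.1.2 | e in hecke_edges g].

End Hecke.
End AdelicGroup.

Arguments GO {F} Fhat _.
Arguments GF {F} Fhat _.

Section ProjectiveLine.
Variable kappa : finFieldType.

(* The point [a : b], as the line through (a, b) in the plane. *)
Definition proj_point (a b : kappa) : {set kappa * kappa} :=
  [set (c * a, c * b) | c in kappa]%SET.

Definition P1 : {set {set kappa * kappa}} :=
  [set proj_point u.1 u.2 | u : kappa * kappa & u != (0, 0)]%SET.

End ProjectiveLine.

(* xi_w is (pi b; 0 1) for w = [1 : b], with b placed at x and 0 elsewhere, and
   (1 0; 0 pi) for the remaining point w = [0 : 1]. *)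
Definition xi (F : fieldType) (Fhat : forall y : place F, completion y)
    (x : place F) (pi : uniformizer (@cval _ _ (Fhat x)))
    (kappa : finFieldType) (iota : kappa -> Fhat x)
    (w : {set kappa * kappa}) : GA Fhat :=
  if [pick b | w == proj_point 1 b] is Some b
  then xi_fin pi (adele_at 0 (iota b)) else xi_inf pi.

(* Main.v *)
(* The double coset K diag(pi_x, 1) K is the disjoint union of the cosets
   xi_w K for w in P^1(kappa_x): a column reduction at x, governed by the
   reduction of the second column of an element of K modulo pi_x.  Each of
   these cosets is open, being a translate of K, and has volume 1 by left
   invariance.  Functions on G(F) \ G(A) / K are right K-invariant, so the Hecke
   integral is the sum of the f([g xi_w]).  Testing an expansion on indicator
   functions of single classes shows that its coefficients count the w with
   [g xi_w] equal to the given class. *)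
Require Import Defs.
From HB Require Import structures.
From mathcomp Require Import all_boot all_order all_algebra all_field.
From mathcomp Require Import all_classical all_reals all_analysis.
From mathcomp Require Import measurable_realfun complex ring.

Set Implicit Arguments.
Unset Strict Implicit.
Unset Printing Implicit Defensive.

Import Order.TTheory GRing.Theory Num.Theory.
Local Open Scope classical_set_scope.
Local Open Scope ring_scope.

Lemma val_fin (L : fieldType) (v : L -> \bar int) (a : L) :
  is_valuation v -> a != 0 -> exists n : int, v a = n%:E.
Proof.
move=> vV a0; have va0 : v a <> +oo%E by move=> /(val_eq_oo vV)/eqP; exact/negP.
have := Defs.val1 vV; rewrite -(divff a0) (Defs.valM vV).
by move: va0; case: (v a) => [n| |] //= _ _; exists n.
Qed.

Lemma integers_mul_near (L : fieldType) (v : L -> \bar int) (c : L) :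
  is_valuation v ->
  exists n : int, forall a, (n%:E <= v a)%E -> integers v (c * a).
Proof.
move=> vV; have [->|c0] := eqVneq c 0.
  by exists 0 => a _; rewrite mul0r; exact: integers0.
have [n vc] := val_fin vV c0; exists (- n) => a na.
rewrite /integers /= (Defs.valM vV) vc.
by case: (v a) na => [m| |] //; rewrite !lee_fin => h; rewrite -lerBlDl sub0r.
Qed.

Lemma valB_trans (L : fieldType) (v : L -> \bar int) (n : \bar int) (a b c : L) :
  is_valuation v -> (n <= v (a - b)%R)%E -> (n <= v (b - c)%R)%E ->
  (n <= v (a - c)%R)%E.
Proof.
move=> vV ab bc; rewrite -(subrKA b a).
by apply: le_trans (Defs.valD vV _ _); rewrite le_min ab.
Qed.

Section Openness.
Variables (F : fieldType) (Fhat : forall y : place F, completion y).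
Local Notation A := (adele Fhat).
Local Notation OO y := (integers (@cval _ _ (Fhat y))).

Lemma near_integral_mul (c a0 : A) :
  nbhs a0 [set a | integral_adele (c * (a - a0))].
Proof.
have [n nP] : {n : place F -> int & forall y (b : Fhat y),
    ((n y)%:E <= cval b)%E -> OO y (c y * b)}.
  by apply: (@choice _ _ (fun y n => forall b : Fhat y,
    (n%:E <= cval b)%E -> OO y (c y * b))) => y;
    exact: integers_mul_near (cval_valuation _).
pose U y : set (Fhat y) := if `[< OO y (c y) /\ OO y (a0 y) >] then OO y
  else [set b | ((n y)%:E <= cval (b - a0 y)%R)%E].
have oU : open (restricted_box U : set A).
  exists [set restricted_box U]; last by rewrite bigcup_set1.
  move=> _ ->; exists U => //; split=> [y|].
    rewrite /U; case: asboolP => _; first exact: open_integers (cval_valuation _).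
    rewrite valuation_openE => a /= na; exists (n y) => b /= nb.
    exact: valB_trans (cval_valuation _) nb na.
  apply: sub_finite_set (finite_setU2 (acomp_fin c) (acomp_fin a0)) => y /=.
  by rewrite /U; case: asboolP => // /not_andP.
apply: filterS (open_nbhs_nbhs (conj oU _)) => [a Ua y|y].
  rewrite adele_compM adele_compD; have := Ua y; rewrite /U.
  case: asboolP => [[Oc Oa0] Oa|_ /=]; last exact: nP.
  apply: integersM (cval_valuation _) _ _ Oc _.
  apply: integersD (cval_valuation _) _ _ Oa _.
  exact: integersN (cval_valuation _) _ Oa0.
rewrite /U; case: asboolP => [[]//|_ /=].
by rewrite subrr (proj2 (val_eq_oo (cval_valuation _) _)) // leey.
Qed.

Lemma integral_adeleD (a b : A) :
  integral_adele a -> integral_adele b -> integral_adele (a + b).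
Proof. by move=> Oa Ob y; exact: integersD (cval_valuation _) _ _ (Oa y) (Ob y). Qed.

Lemma integral_adeleM (a b : A) :
  integral_adele a -> integral_adele b -> integral_adele (a * b).
Proof. by move=> Oa Ob y; exact: integersM (cval_valuation _) _ _ (Oa y) (Ob y). Qed.

Lemma integral_adeleN (a : A) : integral_adele a -> integral_adele (- a).
Proof. by move=> Oa y; exact: integersN (cval_valuation _) _ (Oa y). Qed.

Lemma integral_adele0 : integral_adele (0 : A).
Proof. by move=> y; exact: integers0 (cval_valuation _). Qed.

Lemma integral_adele1 : integral_adele (1 : A).
Proof. by move=> y; exact: integers1 (cval_valuation _). Qed.

Lemma integral_adele_sum (I : finType) (a : I -> A) :
  (forall i, integral_adele (a i)) -> integral_adele (\sum_i a i).
Proof.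
move=> Oa; elim/big_ind: _ => [||i _]; last exact: Oa.
  exact: integral_adele0.
exact: integral_adeleD.
Qed.

Lemma near_integral_mulmx (N N' M0 : 'M[A]_2) :
  nbhs M0 [set M | forall i j, integral_adele ((N *m (M - M0) *m N') i j)].
Proof.
exists (fun k l => [set a | forall ij : 'I_2 * 'I_2,
    integral_adele (N ij.1 k * N' l ij.2 * (a - M0 k l))]).
  move=> k l; exact: (@filter_forall _ _ _ (nbhs (M0 k l)) _
    (fun ij => near_integral_mul (N ij.1 k * N' l ij.2) (M0 k l))).
move=> M HM i j; rewrite mxE; apply: integral_adele_sum => l.
rewrite mxE mulr_suml; apply: integral_adele_sum => k; rewrite mulrAC.
have := HM k l (i, j).
by rewrite !mxE.
Qed.

Lemma nbhs_gl_pair (h : GL2 A) (S : set ('M[A]_2 * 'M[A]_2)) :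
  nbhs (gl_pair h) S -> nbhs h (@gl_pair _ Fhat @^-1` S).
Proof.
rewrite !nbhsE => -[U [oU Uh] US]; exists (@gl_pair _ Fhat @^-1` U).
  by split=> //; exists U.
by move=> ? /US.
Qed.

(* With t represented by t0, a matrix h0 representing a point of t K is
   a *: t0 k0 with k0 in GL_2(O_A); if h is near h0 and h^-1 near h0^-1, then
   k = (a t0)^-1 h and k^-1 differ from k0 and k0^-1 by integral matrices. *)
Lemma open_GO_translate (t : GA Fhat) :
  open [set (t * k)%g | k in GO Fhat].
Proof.
rewrite -(pgl_reprK t); set t0 : GL2 A := repr (t : PGL2 A).
change (open ((@pgl_of A) @^-1` [set (pgl_of t0 * k)%g | k in GO Fhat])).
rewrite openE => h0 [_ [k0 Ok0 <-]] /esym/eqP.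
rewrite [(_ * _)%g]pgl_of_mul eq_sym => /pgl_ofP[a [b [ab /= Eh0]]].
have ba : b * a = 1 by rewrite mulrC.
have Eh0V : gl_inv h0 = b *: (gl_inv k0 *m gl_inv t0).
  have /= Vk := gl_mulVmx (t0 * k0)%g.
  rewrite -[RHS]mulmx1 -(gl_mulmxV h0) mulmxA Eh0 -!(scalemxAl, scalemxAr).
  by rewrite scalerA mulrC ab scale1r Vk mul1mx.
pose near1 : set 'M[A]_2 := [set M | forall i j, integral_adele
  ((b *: gl_inv t0 *m (M - gl_mx h0) *m 1%:M) i j)].
pose near2 : set 'M[A]_2 := [set M | forall i j, integral_adele
  ((1%:M *m (M - gl_inv h0) *m (a *: gl_mx t0)) i j)].
have : nbhs h0 (@gl_pair _ Fhat @^-1` (near1 `*` near2)).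
  apply: nbhs_gl_pair; exists (near1, near2) => //.
  by split; exact: near_integral_mulmx.
rewrite /interior /=; apply: (@filterS _ (nbhs h0)).
move=> h /= []; rewrite /near1 /near2 /gl_pair /= => O1 O2.
have kk1 : (b *: gl_inv t0 *m gl_mx h) *m (gl_inv h *m (a *: gl_mx t0)) = 1%:M.
  rewrite mulmxA -(mulmxA (b *: _)) gl_mulmxV mulmx1 -scalemxAl -scalemxAr.
  by rewrite gl_mulVmx scalerA mulrC ab scale1r.
have kk2 : (gl_inv h *m (a *: gl_mx t0)) *m (b *: gl_inv t0 *m gl_mx h) = 1%:M.
  rewrite mulmxA -(mulmxA (gl_inv h)) -!(scalemxAl, scalemxAr).
  by rewrite gl_mulmxV mulmx1 gl_mulVmx scalerA ab scale1r.
pose k := MkGL2 kk1 kk2.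
exists (pgl_of k).
  exists k => //= i j; have [Ok0ij OVk0ij] := Ok0 i j; split.
    have -> : (b *: gl_inv t0) *m gl_mx h =
        b *: gl_inv t0 *m (gl_mx h - gl_mx h0) + gl_mx k0.
      rewrite mulmxBr Eh0 -!(scalemxAl, scalemxAr) mulmxA gl_mulVmx mul1mx.
      by rewrite scalerA ?ab ?ba scale1r subrK.
    by rewrite mxE; apply: integral_adeleD; rewrite // -[_ *m _]mulmx1.
  have -> : gl_inv h *m (a *: gl_mx t0) =
      (gl_inv h - gl_inv h0) *m (a *: gl_mx t0) + gl_inv k0.
    rewrite mulmxBl Eh0V -!(scalemxAl, scalemxAr) -mulmxA gl_mulVmx mulmx1.
    by rewrite scalerA ?ab ?ba scale1r subrK.
  by rewrite mxE; apply: integral_adeleD; rewrite // -[_ - _]mul1mx.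
rewrite [(_ * _)%g]pgl_of_mul; apply/eqP/pgl_ofP; exists a, b; split=> //=.
by rewrite mulmxA -!(scalemxAl, scalemxAr) gl_mulmxV mul1mx scalerA ab scale1r.
Qed.

End Openness.

Lemma Rintegral_sum_indic (R : realType) (d : measure_display)
    (T : measurableType d) (mu : {measure set T -> \bar R}) (I : finType)
    (E : I -> set T) (c : I -> R) :
  (forall i, measurable (E i)) -> (forall i, mu (E i) = 1%E) ->
  \int[mu]_(t in setT) (\sum_i c i * \1_(E i) t) = \sum_i c i.
Proof.
move=> mE muE.
have iE i : mu.-integrable setT (fun t => (\1_(E i) t)%:E).
  apply/integrableP; split; first exact/measurable_EFinP.
  rewrite (eq_integral (fun t => (\1_(E i) t)%:E)); last first.
    by move=> t _; rewrite gee0_abs // lee_fin.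
  by rewrite integral_indic // setIT muE ltry.
rewrite /Rintegral; under eq_integral do rewrite -sumEFin.
rewrite integral_sum // => [|i]; last exact: (integrableZl measurableT (c i) (iE i)).
rewrite (eq_bigr (fun i => (c i)%:E)) ?sumEFin // => i _.
under eq_integral do rewrite EFinM.
by rewrite integralZl // integral_indic // setIT muE mule1.
Qed.

Section HeckeCosets.
Variables (F : fieldType) (Fhat : forall y : place F, completion y).
Variables (R : realType) (mu : {measure set (borelG Fhat) -> \bar R}).
Hypotheses (mu_haar : haar_measure mu) (mu_K : mu (GO Fhat) = 1%E).

Lemma measurable_GO_translate (t : GA Fhat) :
  measurable ([set (t * k)%g | k in GO Fhat] : set (borelG Fhat)).
Proof. by apply: sub_sigma_algebra; exact: open_GO_translate. Qed.

Lemma measure_GO_translate (t : GA Fhat) :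
  mu [set (t * k)%g | k in GO Fhat] = 1%E.
Proof.
have mGO : measurable (GO Fhat : set (borelG Fhat)).
  have <- : [set (1 * k)%g | k in GO Fhat] = GO Fhat.
    apply/seteqP; split=> [_ [k Ok <-]|k Ok]; first by rewrite mul1g.
    by exists k; rewrite ?mul1g.
  exact: measurable_GO_translate.
by rewrite -mu_K; exact: haar_invl mu_haar _ _ mGO.
Qed.

Lemma dcoset_mulGO (g k : GA Fhat) : GO Fhat k -> dcoset (g * k)%g = dcoset g.
Proof.
move=> Ok; apply/esym/eqquotP/asboolP; exists 1%g; first exact: GF1.
by exists k => //; rewrite mul1g.
Qed.

Variables (x : place F) (pi : uniformizer (@cval _ _ (Fhat x))).
Variables (I : finType) (t : I -> GA Fhat).
Hypothesis support_t :
  hecke_support pi = \bigcup_i [set (t i * k)%g | k in GO Fhat].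
Hypothesis t_inj : forall i j k, GO Fhat k -> t j = (t i * k)%g -> i = j.

Lemma indic_support (f : dcosets Fhat -> R[i]) (phi : R[i] -> R) (g h : GA Fhat) :
  phi 0 = 0 ->
  phi (\1_(hecke_support pi) h * f (dcoset (g * h)%g)) =
  \sum_i phi (f (dcoset (g * t i)%g)) * \1_[set (t i * k)%g | k in GO Fhat] h.
Proof.
move=> phi0; rewrite !indicE support_t.
have [[i _ [k Ok <-]]|nh] := pselect ((\bigcup_i [set (t i * k)%g | k in GO Fhat]) h).
  rewrite mem_set; last by exists i => //; exists k.
  rewrite mul1r mulgA dcoset_mulGO // (bigD1 i) //= indicE mem_set; last by exists k.
  rewrite mulr1 big1 ?addr0 // => j ji; rewrite indicE memNset ?mulr0 // => -[l Ol E].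
  have : t i = (t j * (l * k^-1))%g by rewrite mulgA E mulgK.
  by move/(t_inj (GOM Ol (GOV Ok)))/eqP; exact/negP.
rewrite memNset // mul0r phi0 big1 // => i _.
by rewrite indicE memNset ?mulr0 // => hi; apply: nh; exists i.
Qed.

Lemma heckeE (f : dcosets Fhat -> R[i]) (g : GA Fhat) :
  hecke mu pi f g = \sum_i f (dcoset (g * t i)%g).
Proof.
rewrite /hecke /cintegral.
under eq_Rintegral do rewrite (indic_support f (phi := @complex.Re R)) //.
under [X in Complex _ X]eq_Rintegral do rewrite (indic_support f (phi := @complex.Im R)) //.
have mE i := measurable_GO_translate (t i).
have muE i := measure_GO_translate (t i).
rewrite (Rintegral_sum_indic _ mE muE) (Rintegral_sum_indic _ mE muE).
by rewrite -!raddf_sum; case: (\sum_i _).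
Qed.

Definition hecke_mult (g : GA Fhat) (c : dcosets Fhat) : nat :=
  #|[pred i | dcoset (g * t i)%g == c]|.

Definition hecke_targets (g : GA Fhat) : seq (dcosets Fhat) :=
  undup [seq dcoset (g * t i)%g | i <- enum I].

Lemma mem_hecke_targets (g : GA Fhat) (i : I) :
  dcoset (g * t i)%g \in hecke_targets g.
Proof. by rewrite mem_undup; apply/mapP; exists i; rewrite ?mem_enum. Qed.

Lemma hecke_mult_gt0 (g : GA Fhat) (c : dcosets Fhat) :
  (0 < hecke_mult g c)%N = (c \in hecke_targets g).
Proof.
apply/card_gt0P/idP => [[i /= /eqP <-]|]; first exact: mem_hecke_targets.
by rewrite mem_undup => /mapP[i _ ->]; exists i; apply/eqP.
Qed.

Lemma hecke_multE (g : GA Fhat) (c : dcosets Fhat) :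
  (hecke_mult g c)%:R = \sum_i (dcoset (g * t i)%g == c)%:R :> R[i].
Proof.
rewrite /hecke_mult -sum1_card natr_sum big_mkcond /=.
by apply: eq_bigr => i _; rewrite inE; case: eqP.
Qed.

Lemma sum_hecke_targets (g : GA Fhat) (f : dcosets Fhat -> R[i]) :
  \sum_(c <- hecke_targets g) (hecke_mult g c)%:R * f c =
  \sum_i f (dcoset (g * t i)%g).
Proof.
under eq_bigr do rewrite hecke_multE mulr_suml.
rewrite exchange_big /=; apply: eq_bigr => i _.
rewrite (bigD1_seq (dcoset (g * t i)%g)) ?mem_hecke_targets ?undup_uniq //=.
rewrite eqxx mul1r big1 ?addr0 // => c; rewrite eq_sym => /negbTE ->.
by rewrite mul0r.
Qed.

Lemma hecke_expansion_targets (g : GA Fhat) :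
  hecke_expansion mu pi g
    [seq (c, (hecke_mult g c)%:R) | c <- hecke_targets g].
Proof.
split.
- by rewrite -map_comp map_id_in ?undup_uniq.
- move=> _ /mapP[c ct ->] /=.
  by rewrite pnatr_eq0 -lt0n hecke_mult_gt0.
- by move=> f; rewrite heckeE big_map sum_hecke_targets.
Qed.

Lemma hecke_expansion_mult (g : GA Fhat) s e :
  hecke_expansion mu pi g s -> e \in s -> e.2 = (hecke_mult g e.1)%:R.
Proof.
move=> [us _ sE] es; have := sE (fun c => (c == e.1)%:R).
rewrite heckeE -hecke_multE => ->; rewrite (big_rem e es) /= eqxx mulr1.
have : uniq [seq e.1 | e <- e :: rem e s].
  by rewrite -(perm_uniq (perm_map _ (perm_to_rem es))).
move=> /andP[/negP ne _]; rewrite big_seq big1 ?addr0 // => e' e's.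
case: eqP => [E|_]; last by rewrite mulr0.
by case: ne; rewrite -E map_f.
Qed.

Lemma hecke_edgesE (g : GA Fhat) :
  hecke_edges mu pi g =
  [set` [seq (dcoset g, c, (hecke_mult g c)%:R) | c <- hecke_targets g]].
Proof.
apply/seteqP; split=> e.
  move=> [[c m] [s sE es] <-] /=; have /= -> := hecke_expansion_mult sE es.
  apply: map_f; rewrite -hecke_mult_gt0 lt0n -(pnatr_eq0 R[i]).
  by have /= <- := hecke_expansion_mult sE es; case: sE => _ /(_ _ es).
move=> /mapP[c ct ->]; exists (c, (hecke_mult g c)%:R) => //.
eexists; first exact: hecke_expansion_targets.
exact: map_f.
Qed.

Lemma hecke_neighboursE (g : GA Fhat) :
  hecke_neighbours mu pi g = range (fun i => dcoset (g * t i)%g).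
Proof.
rewrite /hecke_neighbours hecke_edgesE; apply/seteqP; split=> c.
  move=> [_ /mapP[d + ->] <-] /=.
  by rewrite mem_undup => /mapP[i _ ->]; exists i.
move=> [i _ <-]; pose d := dcoset (g * t i)%g.
exists (dcoset g, d, (hecke_mult g d)%:R) => //=.
exact: (map_f (fun c => (dcoset g, c, _)) (mem_hecke_targets g i)).
Qed.

Lemma sum_hecke_edges (g : GA Fhat) :
  \sum_(e \in hecke_edges mu pi g) e.2 = #|I|%:R.
Proof.
rewrite hecke_edgesE -fsbig_seq; last first.
  by rewrite map_inj_uniq ?undup_uniq // => c d [].
rewrite big_map /=; under eq_bigr do rewrite -[_%:R]mulr1.
by rewrite (sum_hecke_targets g (fun=> 1)) sumr_const.
Qed.

End HeckeCosets.

Section Matrix2.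
Variable R : comPzRingType.

Lemma mx2_eta (M : 'M[R]_2) :
  M = mx2 (M ord0 ord0) (M ord0 ord_max) (M ord_max ord0) (M ord_max ord_max).
Proof.
have ord2 (i : 'I_2) : i = ord0 \/ i = ord_max.
  by case: i => [[|[|//]] i2]; [left|right]; exact: val_inj.
apply/matrixP => i j; rewrite mxE.
by case: (ord2 i) => ->; case: (ord2 j) => ->.
Qed.

Lemma mx2_inj (a b c d a' b' c' d' : R) :
  mx2 a b c d = mx2 a' b' c' d' -> [/\ a = a', b = b', c = c' & d = d'].
Proof.
move=> /matrixP E; have := (E ord0 ord0, E ord0 ord_max, E ord_max ord0, E ord_max ord_max).
by rewrite !mxE /= => -[[[-> ->] ->] ->].
Qed.

Lemma scale_mx2 (t a b c d : R) :
  t *: mx2 a b c d = mx2 (t * a) (t * b) (t * c) (t * d).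
Proof. by apply/matrixP => i j; rewrite !mxE; case: ifP => _; case: ifP. Qed.

Lemma mx2_adj (a b c d e : R) : (a * d - b * c) * e = 1 ->
  mx2 a b c d *m mx2 (e * d) (- (e * b)) (- (e * c)) (e * a) = 1%:M /\
  mx2 (e * d) (- (e * b)) (- (e * c)) (e * a) *m mx2 a b c d = 1%:M.
Proof.
move=> E; rewrite !mx2_mul -mx2_1.
split; congr mx2; rewrite -?E; ring.
Qed.

Lemma mx2_det (a b c d a' b' c' d' : R) :
  mx2 a b c d *m mx2 a' b' c' d' = 1%:M ->
  (a * d - b * c) * (a' * d' - b' * c') = 1.
Proof.
rewrite mx2_mul -mx2_1 => /mx2_inj[E1 E2 E3 E4].
transitivity ((a * a' + b * c') * (c * b' + d * d') -
  (a * b' + b * d') * (c * a' + d * c')); first by ring.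
by rewrite E1 E2 E3 E4 mul0r subr0 mul1r.
Qed.

End Matrix2.

Section CosetRepresentatives.
Variables (F : fieldType) (Fhat : forall y : place F, completion y).
Local Notation A := (adele Fhat).
Local Notation OO y := (integers (@cval _ _ (Fhat y))).

Definition integral_gl : set (GL2 A) := [set k |
  forall i j, integral_adele (gl_mx k i j) /\ integral_adele (gl_inv k i j)].

Lemma integral_gl_mx2 (k : GL2 A) : integral_gl k ->
  exists a b c d e, [/\ gl_mx k = mx2 a b c d, (a * d - b * c) * e = 1,
    integral_adele a /\ integral_adele b,
    integral_adele c /\ integral_adele d & integral_adele e].
Proof.
move=> Ok; have := gl_mulmxV k.
rewrite [gl_mx k]mx2_eta [gl_inv k]mx2_eta => /mx2_det E.
do 5!eexists; split; [reflexivity|exact: E|..].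
- by split; apply Ok.
- by split; apply Ok.
by apply: integral_adeleD; last apply: integral_adeleN;
  apply: integral_adeleM; apply Ok.
Qed.

Lemma mx2_integral_gl (a b c d e : A) : (a * d - b * c) * e = 1 ->
  integral_adele a -> integral_adele b -> integral_adele c ->
  integral_adele d -> integral_adele e ->
  exists2 k, integral_gl k & gl_mx k = mx2 a b c d.
Proof.
move=> /mx2_adj[kV Vk] Oa Ob Oc Od Oe; exists (MkGL2 kV Vk) => //.
have ON := integral_adeleN; have OM := integral_adeleM.
by move=> i j /=; rewrite !mxE; do 2!case: ifP => _; split; auto.
Qed.

Lemma adele_at_in (a : A) (x : place F) (t : Fhat x) : adele_at a t x = t.
Proof. exact: eqtype.dfwith_in. Qed.

Lemma adele_at_out (a : A) (x y : place F) (t : Fhat x) :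
  x != y -> adele_at a t y = a y.
Proof. exact: eqtype.dfwith_out. Qed.

Lemma integral_adele_at (a : A) (x : place F) (t : Fhat x) :
  integral_adele a -> OO x t -> integral_adele (adele_at a t).
Proof.
move=> Oa Ot y; have [<-|xy] := eqVneq x y; first by rewrite adele_at_in.
by rewrite adele_at_out.
Qed.

Variables (x : place F) (pi : uniformizer (@cval _ _ (Fhat x))).
Variables (kappa : finFieldType) (res : Fhat x -> kappa).
Hypothesis res_map : is_residue_map (@cval _ _ (Fhat x)) res.
Variable iota : {rmorphism kappa -> Fhat x}.
Hypothesis iota_res : is_residue_embedding (@cval _ _ (Fhat x)) res iota.

Let vV := cval_valuation (Fhat x).
Local Notation "'ϖ'" := (unif_idele pi).
Local Notation "'ϖV'" := (adele_at (1 : A) (unif pi)^-1).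

Lemma unif_ideleE : (ϖ : A) x = unif pi.
Proof. exact: adele_at_in. Qed.

Lemma integral_unif : integral_adele ϖ.
Proof.
apply: integral_adele_at; first exact: integral_adele1.
by rewrite /integers /= unif_val lee_fin.
Qed.

Lemma integral_mul_unifV (u : A) : integral_adele u ->
  (0 < cval (u x))%E -> integral_adele (u * ϖV).
Proof.
move=> Ou ux y; rewrite adele_compM.
have [<-|xy] := eqVneq x y; last by rewrite adele_at_out // mulr1.
rewrite adele_at_in /integers /=.
have : u x = (u x * (unif pi)^-1) * unif pi by rewrite divfK ?unif_neq0.
move: (u x / unif pi) => w wE; move: ux; rewrite wE (Defs.valM vV) unif_val.
case: (cval w) => [n| |] //.
by rewrite lte_fin lee_fin => n1; rewrite -(lerD2r 1) add0r -gtz0_ge1.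
Qed.

Lemma unif_mul_neq1 (u : Fhat x) : OO x u -> unif pi * u != 1.
Proof.
rewrite /integers /= => Ou; apply/eqP => /(congr1 (@cval _ _ (Fhat x))).
rewrite (Defs.valM vV) unif_val (Defs.val1 vV).
case: (cval u) Ou => [n| |] //=; rewrite lee_fin => n0 [] /eqP.
by rewrite addrC gt_eqF // ltzD1.
Qed.

Definition xi_gl (o : option kappa) : GL2 A :=
  if o is Some b then gl_upper (adele_at 0 (iota b)) (unif_ideleV pi) (mulr1 1)
  else gl_upper 0 (mulr1 1) (unif_ideleV pi).

Definition xi_opt (o : option kappa) : GA Fhat := pgl_of (xi_gl o).

Lemma integral_iota (b : kappa) : integral_adele (adele_at (0 : A) (iota b)).
Proof.
apply: integral_adele_at; first exact: integral_adele0.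
by have [] := iota_res b.
Qed.

Lemma xi_opt_support (o : option kappa) : hecke_support pi (xi_opt o).
Proof.
have O0 := @integral_adele0 _ Fhat; have O1 := @integral_adele1 _ Fhat.
case: o => [b|].
  have E : ((1 : A) * 1 - adele_at 0 (iota b) * 0) * 1 = 1 by ring.
  have [u Ou uE] := mx2_integral_gl E O1 (integral_iota b) O0 O1 O1.
  exists (pgl_of u, 1%g); first by split; [exists u|exact: GO1].
  rewrite /= mulg1 /xi_fin [(_ * _)%g]pgl_of_mul; congr pgl_of; apply: gl_ext.
  by rewrite /= uE mx2_mul; congr mx2; ring.
have E : ((0 : A) * 0 - 1 * 1) * (- 1) = 1 by ring.
have [u Ou uE] := mx2_integral_gl E O0 O1 O1 O0 (integral_adeleN O1).
exists (pgl_of u, pgl_of u); first by split; exists u.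
rewrite /= /xi_fin [(pgl_of u * _)%g]pgl_of_mul [(_ * _)%g]pgl_of_mul.
by congr pgl_of; apply: gl_ext; rewrite /= uE !mx2_mul; congr mx2; ring.
Qed.

(* The reduction mod pi of the second column [(b, d)] of [k] decides the class:
   [[1 : b / d]] if [d] is a unit at [x], and [[0 : 1]] otherwise. *)
Lemma integral_gl_xi (k : GL2 A) : integral_gl k ->
  exists o, exists2 l, integral_gl l &
    gl_mx k *m mx2 ϖ 0 0 1 = gl_mx (xi_gl o) *m gl_mx l.
Proof.
move=> /integral_gl_mx2[a [b [c [d [e [kE E [Oa Ob] [Oc Od] Oe]]]]]].
have piV : ϖ * ϖV = 1 := unif_ideleV pi.
have Opi := integral_unif.
have ON := @integral_adeleN _ Fhat; have OM := @integral_adeleM _ Fhat.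
have OD := @integral_adeleD _ Fhat.
have [dx|dx] := boolP (0 < cval (d x))%E.
  have OdV := integral_mul_unifV Od dx.
  have E' : (a * ϖ * (d * ϖV) - b * c) * e = 1.
    rewrite -[RHS]E; transitivity ((a * d * (ϖ * ϖV) - b * c) * e); first by ring.
    by rewrite piV mulr1.
  have [l Ol lE] := mx2_integral_gl E' (OM _ _ Oa Opi) Ob Oc OdV Oe.
  have dE : ϖ * (d * ϖV) = d by rewrite mulrCA piV mulr1.
  by exists None, l => //; rewrite kE lE !mx2_mul dE; congr mx2; ring.
have dx0 : res (d x) != 0.
  by apply/eqP => /(res_ker res_map (Od x)); exact/negP.
pose r := res (b x) / res (d x); pose t : A := adele_at 0 (iota r).
have Ot : integral_adele t := integral_iota r.
have Obt : integral_adele ((b - t * d) * ϖV).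
  apply: integral_mul_unifV; first by auto.
  have Obd : integral_adele (b - t * d) by auto.
  apply/(res_ker res_map (Obd x)); apply: (addIr (res (t x * d x))).
  have [Or rE] := iota_res r.
  rewrite -(res_add res_map (Obd x) (OM _ _ Ot Od x)) subrK add0r.
  by rewrite (res_mul res_map (Ot x) (Od x)) [t x]adele_at_in rE divfK.
have E' : ((a - t * c) * d - (b - t * d) * ϖV * (ϖ * c)) * e = 1.
  rewrite -[RHS]E; transitivity
    (((a - t * c) * d - (b - t * d) * c * (ϖ * ϖV)) * e); first by ring.
  by rewrite piV; ring.
have Oatc : integral_adele (a - t * c) by auto.
have [l Ol lE] := mx2_integral_gl E' Oatc Obt (OM _ _ Opi Oc) Od Oe.
have bE : ϖ * ((b - t * d) * ϖV) = b - t * d by rewrite mulrCA piV mulr1.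
exists (Some r), l => //; rewrite kE lE !mx2_mul bE -/t.
by congr mx2; ring.
Qed.

Lemma xi_opt_inj (o o' : option kappa) (k : GA Fhat) :
  GO Fhat k -> xi_opt o' = (xi_opt o * k)%g -> o = o'.
Proof.
move=> [l Ol <-]; rewrite /xi_opt [(_ * _)%g]pgl_of_mul => /eqP/pgl_ofP.
move=> [u [v [uv /=]]].
have [a [b [c [d [e [lE E [Oa Ob] [Oc Od] Oe]]]]]] := integral_gl_mx2 Ol.
have atx (p q : A) : p = q -> p x = q x by move=> ->.
have Ex : (a x * d x - b x * c x) * e x = 1 := atx _ _ E.
have pi0 := unif_neq0 pi.
have OM := @integral_adeleM _ Fhat; have Opi := integral_unif.
rewrite lE.
case: o o' => [r|] [r'|] //=; rewrite mx2_mul scale_mx2 => /mx2_inj[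
  /atx E1 /atx E2 /atx E3 /atx E4]; move: E1 E2 E3 E4;
  rewrite !(adele_compD, adele_compM, adele_comp0, adele_comp1, adele_at_in,
    unif_ideleE) !(mulr0, mul0r, add0r, addr0, mul1r, mulr1) => E1 E2 E3 E4.
- have Ow : OO x (b x * (a x * e x)) by exact: (OM _ _ Ob (OM _ _ Oa Oe) x).
  have iE : iota r' = iota r + unif pi * (b x * (a x * e x)).
    rewrite -[LHS]mulr1 -Ex E3 mulr0 subr0 E4.
    transitivity (u x * iota r' * (a x * e x)); first by ring.
    rewrite -E2 mulrDl addrC; congr (_ + _); last by ring.
    by rewrite -[RHS]mulr1 -Ex E3; ring.
  have [[Or rE] [_ r'E]] := (iota_res r, iota_res r').
  congr Some; rewrite -rE -r'E iE (res_add res_map) //; last first.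
    by rewrite /integers /= (Defs.valM vV) unif_val adde_ge0 // lee_fin.
  rewrite (_ : res (unif pi * _) = 0) ?addr0 //.
  apply/(res_ker res_map); rewrite /integers /= (Defs.valM vV) unif_val.
    by rewrite adde_ge0 // lee_fin.
  by apply: lt_le_trans (leeDl _ Ow); rewrite lte_fin.
- have /eqP := unif_mul_neq1 (OM _ _ Oa (OM _ _ Oa (OM _ _ Opi Oe)) x).
  case; rewrite !adele_compM unif_ideleE -[RHS]Ex E4 E3 -E1 E3; ring.
have c0 : c x = 0 by apply/eqP; move/eqP: E3; rewrite mulf_eq0 (negbTE pi0).
have /eqP := unif_mul_neq1 (OM _ _ Od (OM _ _ Od (OM _ _ Opi Oe)) x).
case; rewrite !adele_compM unif_ideleE -[RHS]Ex E1 -E4 c0; ring.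
Qed.

Lemma hecke_supportE :
  hecke_support pi = \bigcup_o [set (xi_opt o * k)%g | k in GO Fhat].
Proof.
apply/seteqP; split=> h.
  move=> [[k1 k2] [/= [k Ok <-] Ok2] <-].
  have [w [l Ol E]] := integral_gl_xi Ok; exists w => //.
  exists (pgl_of l * k2)%g; first by apply: GOM => //; exists l.
  rewrite mulgA; congr (_ * _)%g; rewrite /xi_opt /xi_fin.
  rewrite [LHS]pgl_of_mul [RHS]pgl_of_mul.
  by congr pgl_of; apply: gl_ext; rewrite /= E.
move=> [w _ [k Ok <-]].
have [[k1 k2] [/= Ok1 Ok2] <-] := xi_opt_support w.
by exists (k1, (k2 * k)%g); rewrite /= ?mulgA //; split => //=; exact: GOM.
Qed.

End CosetRepresentatives.

Section ProjectiveLinePoints.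
Variable kappa : finFieldType.

Definition P1_point (o : option kappa) : {set kappa * kappa} :=
  if o is Some b then proj_point 1 b else proj_point 0 1.

Lemma proj_pointZ (t a b : kappa) : t != 0 ->
  proj_point (t * a) (t * b) = proj_point a b.
Proof.
move=> t0; apply/setP => u; apply/imsetP/imsetP => -[c _ ->].
  by exists (c * t); rewrite ?mulrA.
by exists (c / t); rewrite // !mulrA divfK.
Qed.

Lemma P1_point_inj : injective P1_point.
Proof.
have p1b (b : kappa) : (1, b) \in proj_point 1 b by apply/imsetP; exists 1; rewrite // !mul1r.
move=> [b|] [b'|] //= E; last 2 first.
- have := p1b b; rewrite E => /imsetP[c _ [/eqP]].
  by rewrite mulr0 oner_eq0.
- have := p1b b'; rewrite -E => /imsetP[c _ [/eqP]].
  by rewrite mulr0 oner_eq0.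
have := p1b b; rewrite E => /imsetP[c _ [/esym]].
by rewrite mulr1 => -> ->; rewrite mul1r.
Qed.

Lemma P1E : P1 kappa = [set P1_point o | o in [set: option kappa]]%SET.
Proof.
apply/setP => w; apply/imsetP/imsetP => [[[a b] + ->] | [[b|] _ ->]] /=.
- rewrite inE xpair_eqE negb_and; have [->|a0 _] := eqVneq a 0.
    move=> /= b0; exists None; rewrite ?inE //=.
    by rewrite -[RHS](proj_pointZ _ _ b0) mulr0 mulr1.
  exists (Some (b / a)); rewrite ?inE //=.
  by rewrite -[RHS](proj_pointZ _ _ a0) mulr1 mulrC divfK.
- by exists (1, b); rewrite // inE xpair_eqE oner_eq0.
- by exists (0, 1); rewrite // inE xpair_eqE oner_eq0 andbF.
Qed.

Lemma card_P1 : #|P1 kappa| = #|kappa|.+1.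
Proof. by rewrite P1E card_imset ?cardsT ?card_option //; exact: P1_point_inj. Qed.

End ProjectiveLinePoints.

Lemma xi_P1_point (F : fieldType) (Fhat : forall y : place F, completion y)
    (x : place F) (pi : uniformizer (@cval _ _ (Fhat x)))
    (kappa : finFieldType) (iota : {rmorphism kappa -> Fhat x}) (o : option kappa) :
  xi pi iota (P1_point o) = xi_opt pi iota o.
Proof.
rewrite /xi; case: pickP => [b /eqP|].
  by rewrite -[proj_point 1 b]/(P1_point (Some b)) => /(@P1_point_inj _) ->.
by case: o => [b|] // /(_ b); rewrite eqxx.
Qed.

Theorem proposition2p3 (R : realType)
    (Fq : finFieldType) (F : fieldExtType {fraction {poly Fq}})
    (Fhat : forall y : place F, completion y)
    (mu : {measure set (borelG Fhat) -> \bar R})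
    (mu_haar : haar_measure mu) (mu_K : mu (GO Fhat) = 1%E)
    (x : place F) (pi_x : uniformizer (@cval _ _ (Fhat x)))
    (kappa_x : finFieldType) (q_x : nat) (card_kappa : #|kappa_x| = q_x)
    (res : Fhat x -> kappa_x)
    (res_map : is_residue_map (@cval _ _ (Fhat x)) res)
    (iota : {rmorphism kappa_x -> Fhat x})
    (iota_res : is_residue_embedding (@cval _ _ (Fhat x)) res iota)
    (g : GA Fhat) :
  [/\ hecke_neighbours mu pi_x g =
        [set dcoset (g * xi pi_x iota w)%g | w in [set w | w \in P1 kappa_x]],
      forall (c : dcosets Fhat) (m : R[i]),
        hecke_edges mu pi_x g (dcoset g, c, m) ->
        m = #|[set w in P1 kappa_x | dcoset (g * xi pi_x iota w)%g == c]%SET|%:R,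
      \sum_(e \in hecke_edges mu pi_x g) e.2 = #|P1 kappa_x|%:R &
      #|P1 kappa_x| = q_x.+1].
Proof.
have sE := hecke_supportE pi_x res_map iota_res.
have t_inj := xi_opt_inj (pi := pi_x) res_map iota_res.
split.
- rewrite (hecke_neighboursE mu_haar mu_K sE t_inj); apply/seteqP; split=> c /=.
    move=> [v _ <-]; exists (P1_point v); last by rewrite xi_P1_point.
    by rewrite P1E imset_f.
  move=> [w]; rewrite P1E => /imsetP[v _ ->] <-.
  by exists v => //; rewrite xi_P1_point.
- move=> c m; rewrite (hecke_edgesE mu_haar mu_K sE t_inj) => /mapP[_ _ [<- ->]].
  congr (_%:R); rewrite /hecke_mult -(card_imset _ (@P1_point_inj kappa_x)).
  apply: eq_card => w; rewrite inE P1E; apply/imsetP/andP.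
    move=> [v cE ->]; rewrite imset_f //; split=> //.
    by rewrite xi_P1_point.
  by move=> [/imsetP[v _ ->]]; rewrite xi_P1_point; exists v.
- by rewrite (sum_hecke_edges mu_haar mu_K sE t_inj) card_P1 card_option.
- by rewrite card_P1 card_kappa.
Qed.
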